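(* Let $\Bbbk$ be an algebraically closed field of characteristic zero and $n\ge 2$. Let $M_1,\dots,M_k$ be a sequence of pairwise distinct symmetric matrices of order $n$ over $\Bbbk$. Assume that $M_1',\dots,M_k'$ is another such sequence with $$\operatorname{rk}(M_i)=\operatorname{rk}(M_i')\ge 2\quad\text{and}\quad\det(M_i)=\det(M_i')\qquad\forall i=1,\dots,k.$$ Then there exists an automorphism $g\in G_{\mathrm{sym}}$ with $g.M_i=M_i'$ for $i=1,\dots,k$.
   Context: Let $X$ be the affine space of symmetric $n\times n$ matrices over $\Bbbk$. The group $\mathrm{SL}_n$ acts on $X$ via $A.B=ABA^T$. For $i\ne j$ let $E_{ij}$ be the matrix with $(i,j)$-entry $1$ and all other entries $0$, and let $H_{ij}=I_n+\Bbbk E_{ij}\subseteq\mathrm{SL}_n$, acting on $X$ through this action as a one-parameter unipotent subgroup $\exp(\Bbbk\delta_{ij})$, where $\delta_{ij}$ is the corresponding locally nilpotent derivation of $\mathcal{O}(X)$. A replica of $H_{ij}$ is a subgroup $\exp(\Bbbk f\delta_{ij})\subseteq\mathrm{Aut}(X)$ with $f\in\ker\delta_{ij}$. $G_{\mathrm{sym}}\subseteq\mathrm{Aut}(X)$ is the subgroup generated by all $H_{ij}$ ($i\ne j$) along with all their replicas. *)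

(* Defs.v *)
From HB Require Import structures.
From mathcomp Require Import all_boot all_order all_algebra.
From mathcomp Require Export mpoly.
Set Implicit Arguments. Unset Strict Implicit. Unset Printing Implicit Defensive.
Import GRing.Theory.
Local Open Scope ring_scope.

Record symmx (K : closedFieldType) (n : nat) : Type :=
  SymMx { symval :> 'M[K]_n ; _ : symval^T == symval }.

HB.instance Definition _ (K : closedFieldType) (n : nat) :=
  [isSub for @symval K n].
HB.instance Definition _ (K : closedFieldType) (n : nat) :=
  [Choice of symmx K n by <:].

Lemma congr_symP (K : closedFieldType) (n : nat) (A : 'M[K]_n) (B : symmx K n) :
  (A *m B *m A^T)^T == A *m B *m A^T.
Proof. by rewrite !trmx_mul trmxK (eqP (valP B)) mulmxA. Qed.

Definition congr_act (K : closedFieldType) (n : nat) (A : 'M[K]_n)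
    (B : symmx K n) : symmx K n := SymMx (congr_symP A B).

Definition elem_mx (R : comNzRingType) (n : nat) (i j : 'I_n) (t : R) : 'M[R]_n :=
  1%:M + t *: delta_mx i j.

(* The coordinates on X are the entries (a, b) with a <= b, numbered through
   enum_rank; O(X) is the polynomial ring in these coordinates. *)
Definition upper (n : nat) := {ab : 'I_n * 'I_n | (ab.1 <= ab.2)%N}.

Lemma upper_ofP (n : nat) (a b : 'I_n) :
  let ab := if (a <= b)%N then (a, b) else (b, a) in (ab.1 <= ab.2)%N.
Proof. by case: (leqP a b) => //= /ltnW. Qed.

Definition upper_of (n : nat) (a b : 'I_n) : upper n :=
  exist (fun ab : 'I_n * 'I_n => is_true (ab.1 <= ab.2)%N) _ (upper_ofP a b).

Notation coord_ring K n := {mpoly K[#|{: upper n}|]}.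

Definition entry (R : Type) (n : nat) (B : 'M[R]_n) (v : 'I_#|{: upper n}|) : R :=
  B (val (enum_val v)).1 (val (enum_val v)).2.

Definition generic_symmx (K : closedFieldType) (n : nat) : 'M[coord_ring K n]_n :=
  \matrix_(a, b) 'X_(enum_rank (upper_of a b)).

Definition evalX (K : closedFieldType) (n : nat) (p : coord_ring K n)
    (B : symmx K n) : K := p.@[entry B].

Definition is_comorphism (K : closedFieldType) (n : nat)
    (g : symmx K n -> symmx K n) (phi : coord_ring K n -> coord_ring K n) : Prop :=
  forall (p : coord_ring K n) (B : symmx K n), evalX (phi p) B = evalX p (g B).

Definition regular_map (K : closedFieldType) (n : nat)
    (g : symmx K n -> symmx K n) : Prop :=
  forall p : coord_ring K n, exists q : coord_ring K n,
    forall B : symmx K n, evalX q B = evalX p (g B).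

Record autX (K : closedFieldType) (n : nat) : Type := AutX {
  aut_fun :> symmx K n -> symmx K n ;
  aut_inv : symmx K n -> symmx K n ;
  aut_funK : cancel aut_fun aut_inv ;
  aut_invK : cancel aut_inv aut_fun ;
  aut_fun_regular : regular_map aut_fun ;
  aut_inv_regular : regular_map aut_inv }.

Lemma regular_id (K : closedFieldType) (n : nat) : regular_map (@id (symmx K n)).
Proof. by move=> p; exists p. Qed.

Lemma regular_comp (K : closedFieldType) (n : nat)
  (g h : symmx K n -> symmx K n) :
  regular_map g -> regular_map h -> regular_map (g \o h).
Proof.
move=> rg rh p; have [q qE] := rg p; have [r rE] := rh q.
by exists r => B; rewrite rE qE.
Qed.

Definition aut_id (K : closedFieldType) (n : nat) : autX K n :=
  AutX (fun=> erefl) (fun=> erefl) (@regular_id K n) (@regular_id K n).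

Definition aut_comp (K : closedFieldType) (n : nat) (g h : autX K n) : autX K n :=
  AutX (can_comp (aut_funK g) (aut_funK h)) (can_comp (aut_invK h) (aut_invK g))
    (regular_comp (aut_fun_regular g) (aut_fun_regular h))
    (regular_comp (aut_inv_regular h) (aut_inv_regular g)).

Definition aut_opp (K : closedFieldType) (n : nat) (g : autX K n) : autX K n :=
  AutX (aut_invK g) (aut_funK g) (aut_inv_regular g) (aut_fun_regular g).

Inductive generated (K : closedFieldType) (n : nat) (S : autX K n -> Prop) :
    autX K n -> Prop :=
| generated_base g : S g -> generated S g
| generated_id : generated S (aut_id K n)
| generated_comp g h : generated S g -> generated S h -> generated S (aut_comp g h)
| generated_inv g : generated S g -> generated S (aut_opp g).

(* p(B) |-> p((I + tE_ij) B (I + tE_ij)^T), as a polynomial in t with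
   coefficients in O(X); delta_ij is its derivative at t = 0. *)
Definition coaction (K : closedFieldType) (n : nat) (i j : 'I_n)
    (p : coord_ring K n) : {poly coord_ring K n} :=
  let A := elem_mx i j ('X : {poly coord_ring K n}) in
  mmap (polyC \o @mpolyC _ K)
    (entry (A *m map_mx polyC (generic_symmx K n) *m A^T)) p.

Definition delta (K : closedFieldType) (n : nat) (i j : 'I_n)
    (p : coord_ring K n) : coord_ring K n := (coaction i j p)^`().[0].

(* phi = exp D; the existence of N for every p says that D is locally
   nilpotent, and the value of the sum does not depend on the choice of N. *)
Definition is_exp (K : fieldType) (V : lmodType K) (D phi : V -> V) : Prop :=
  forall p : V, exists N : nat, iter N D p = 0 /\
    phi p = \sum_(m < N) (m`!%:R : K)^-1 *: iter m D p.

Definition in_H (K : closedFieldType) (n : nat) (i j : 'I_n) (g : autX K n) : Prop :=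
  exists t : K, g =1 congr_act (elem_mx i j t).

Definition in_replica (K : closedFieldType) (n : nat) (i j : 'I_n)
    (f : coord_ring K n) (g : autX K n) : Prop :=
  exists (t : K) (phi : coord_ring K n -> coord_ring K n),
    is_exp (fun p => t *: (f * delta i j p)) phi /\ is_comorphism g phi.

Definition Gsym (K : closedFieldType) (n : nat) : autX K n -> Prop :=
  generated (fun g => exists i j : 'I_n, i != j /\
    (in_H i j g \/
     exists f : coord_ring K n, delta i j f = 0 /\ in_replica i j f g)).

(* Main.v *)
Require Import Defs.
From mathcomp Require Import all_boot all_order all_algebra ring.
Set Implicit Arguments. Unset Strict Implicit. Unset Printing Implicit Defensive.
Import GRing.Theory.
Local Open Scope ring_scope.

(** For a vector [v] write [q_v(B) = v^T B v]. If [v^T u = 0], the function [q_v]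
    is invariant under the transvection [1 + u v^T], so for every polynomial [p]
    in one variable [B |-> (1 + p(q_v(B)) u v^T).B] is an automorphism of the
    space of symmetric matrices. It belongs to the group generated by the
    replicas: when [u] and [v] are basis vectors [e_i] and [e_j] it is the
    exponential of [f] times the derivation attached to [H_ij], with [f] the
    polynomial [p] in the diagonal entry [B_jj], and the general case is
    conjugate to this one by a product of elementary matrices
    ([sym_move_transv]). Choosing [p] by interpolation, one can move [x] to
    [(1 + u v^T).x] and fix a finite set [F] as soon as [q_v] separates [x] from
    the points of [F] ([linked_transv]). Distinct symmetric matrices define
    distinct quadratic forms, so this holds for generic [v].

    To reach a given point [g.x], where [g] is a product of elementary matrices,
    take the path [x -> s.x -> g.s.x -> g.x] with a generic transvection
    [s = 1 + u v^T]; the last arrow is the transvection [g s^-1 g^-1]. The first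
    and the last arrow only require that [q_v] separate [x] from finitely many
    other points. The arrow in the middle is a succession of elementary
    matrices, and it can be carried out unless [(u, v)] satisfies one of
    finitely many polynomial equations, none of which holds identically
    ([elementary_avoid], [generic_moved_quad]). Hence the pointwise stabilizer
    of [F] acts transitively on each orbit of the elementary group deprived of
    [F] ([linked_elementary]).

    Rank and determinant determine the orbit of a symmetric matrix under the
    elementary group, by Lagrange's diagonalization ([elementary_orbit]), and
    the theorem follows by induction on the number of points.

    That the maps above are exponentials rests on Taylor's formula: the coaction
    of [H_ij] solves a differential equation, which has only to be checked on
    the coordinates ([coaction_flow]), and it follows that the exponential of
    [f] times the derivation is the coaction with [f] substituted for the
    parameter ([flow_exp]). *)

(** * Exponentials of derivations from polynomial flows *)

(** A property of polynomials that is compatible with sums and products has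
    only to be checked on constants and variables; identities between ring
    morphisms, and between derivations along them, are such properties. *)
Lemma mpoly_gen_ind (R : comNzRingType) (N : nat) (P : {mpoly R[N]} -> Prop) :
  (forall c, P c%:MP) -> (forall v, P 'X_v) ->
  (forall p q, P p -> P q -> P (p + q)) ->
  (forall p q, P p -> P q -> P (p * q)) -> forall p, P p.
Proof.
move=> PC PX PD PM; elim/mpolyind => [|c m p _ _ Pp]; first by rewrite -mpolyC0.
apply: (PD) => //; rewrite -mul_mpolyC; apply: (PM) => //.
rewrite mpolyXE_id; elim/big_ind: _ => [|p1 p2 P1 P2|v _]; first exact: PC 1.
  exact: (PM).
by elim: (m v) => [|e IHe]; rewrite ?expr0 ?exprS; [apply: PC 1 | apply: (PM)].
Qed.

Lemma elem_mx_mull (R : comNzRingType) n (i j : 'I_n) (t : R) (B : 'M[R]_n) a b :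
  (elem_mx i j t *m B) a b = B a b + (a == i)%:R * (t * B j b).
Proof.
rewrite /elem_mx mulmxDl mul1mx -scalemxAl !mxE; congr (_ + _).
rewrite (bigD1 j) //= big1 => [|k /negPf nkj]; last first.
  by rewrite mxE nkj andbF mul0r.
by rewrite addr0 mxE eqxx andbT mulrCA.
Qed.

Lemma elem_mx_congrE (R : comNzRingType) n (i j : 'I_n) (t : R) (B : 'M[R]_n) a b :
  (elem_mx i j t *m B *m (elem_mx i j t)^T) a b =
    B a b + (a == i)%:R * (t * B j b) + (b == i)%:R * (t * B a j)
    + (a == i)%:R * (b == i)%:R * (t ^+ 2 * B j j).
Proof.
have -> : elem_mx i j t *m B *m (elem_mx i j t)^T
        = (elem_mx i j t *m (elem_mx i j t *m B)^T)^T by rewrite trmx_mul trmxK.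
by rewrite [LHS]mxE elem_mx_mull ![_^T _ _]mxE !elem_mx_mull; ring.
Qed.

(** Here [co] plays the part of a one-parameter group: it sends a function [p]
    to its translate by the parameter ['X], a polynomial in ['X]. *)
Section Flow.
Variables (K : fieldType) (R : comAlgType K) (co : {rmorphism R -> {poly R}}).

Definition flow_der (p : R) : R := (co p)^`().[0].
Definition flow_start (p : R) : Prop := (co p).[0] = p.
(** The one-parameter group law, differentiated at the identity. *)
Definition flow_eq (p : R) : Prop := (co p)^`() = co (flow_der p).

Lemma flow_startD p q : flow_start p -> flow_start q -> flow_start (p + q).
Proof. by rewrite /flow_start rmorphD hornerD => -> ->. Qed.

Lemma flow_startM p q : flow_start p -> flow_start q -> flow_start (p * q).
Proof. by rewrite /flow_start rmorphM hornerM => -> ->. Qed.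

Lemma flow_derD p q : flow_der (p + q) = flow_der p + flow_der q.
Proof. by rewrite /flow_der rmorphD derivD hornerD. Qed.

Lemma flow_eqD p q : flow_eq p -> flow_eq q -> flow_eq (p + q).
Proof. by rewrite /flow_eq flow_derD !rmorphD /= derivD => -> ->. Qed.

Lemma flow_derC p c : co p = c%:P -> flow_der p = 0.
Proof. by rewrite /flow_der => ->; rewrite derivC horner0. Qed.

Lemma flow_eqC p c : co p = c%:P -> flow_eq p.
Proof. by move=> cop; rewrite /flow_eq (flow_derC cop) cop derivC rmorph0. Qed.

Hypothesis start : forall p, flow_start p.

Lemma flow_derM p q : flow_der (p * q) = flow_der p * q + p * flow_der q.
Proof. by rewrite /flow_der rmorphM derivM hornerD !hornerM !start. Qed.

Lemma flow_eqM p q : flow_eq p -> flow_eq q -> flow_eq (p * q).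
Proof.
rewrite /flow_eq flow_derM rmorphD !rmorphM /= derivM => -> ->.
by [].
Qed.

Hypothesis flow : forall p, flow_eq p.

Lemma flow_derivn m p : (co p)^`(m) = co (iter m flow_der p).
Proof. by elim: m => [|m IHm]; rewrite ?derivn0 // derivnS IHm flow. Qed.

(** Taylor's formula: by the flow equation the [m]-th derivative of [co p]
    at the origin is the [m]-th iterate of the infinitesimal generator. *)
Lemma flow_coef m p : (co p)`_m *+ m`! = iter m flow_der p.
Proof.
rewrite -[RHS]start /= -flow_derivn horner_coef0 coef_derivn addn0.
by rewrite ffactnn.
Qed.

(** An element killed by a derivation is a scalar for it, so it comes out of
    the iterates. *)
Lemma flow_der_iterM f m p : flow_der f = 0 ->
  iter m (fun q => 1 *: (f * flow_der q)) p = f ^+ m * iter m flow_der p.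
Proof.
move=> df0; elim: m => [|m IHm]; first by rewrite mul1r.
have dfm : flow_der (f ^+ m) = 0.
  elim: m {IHm} => [|m IHm]; last by rewrite exprS flow_derM df0 IHm mul0r mulr0 addr0.
  by apply: (@flow_derC _ 1); rewrite rmorph1.
by rewrite /= IHm flow_derM dfm mul0r add0r scale1r exprS mulrA.
Qed.

(** Following the flow for the time [f] is the exponential of [f] times its
    generator when [f] is constant along the flow: substitute [f] for ['X] in
    Taylor's formula. Local nilpotency holds because [co p] is a polynomial. *)
Lemma flow_exp f : [pchar K] =i pred0 -> flow_der f = 0 ->
  is_exp (fun q => (1 : K) *: (f * flow_der q)) (fun p => (co p).[f]).
Proof.
move=> charK0 df0 p; exists (size (co p)); split.
  by rewrite flow_der_iterM // -flow_coef nth_default // mul0rn mulr0.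
rewrite horner_coef; apply: eq_bigr => m _.
rewrite flow_der_iterM // -flow_coef mulrnAr -scaler_nat scalerA.
rewrite mulVf ?scale1r 1?mulrC //.
by rewrite ((pcharf0P K).1 charK0) -lt0n fact_gt0.
Qed.

End Flow.

(** The entries of a symmetric matrix moved by an elementary matrix are
    quadratic in the parameter; the next lemmas describe such polynomials over
    an arbitrary ring. *)
Lemma quadratic_start (R : comNzRingType) (c a b : R) :
  (c%:P + a%:P * 'X + b%:P * 'X^2).[0] = c.
Proof. by rewrite !hornerE /=; ring. Qed.

Lemma quadratic_horner (R : comNzRingType) (c a b t : R) :
  (c%:P + a%:P * 'X + b%:P * 'X^2).[t] = c + a * t + b * t ^+ 2.
Proof. by rewrite !hornerE. Qed.

Lemma quadratic_deriv (R : comNzRingType) (c a b : R) :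
  (c%:P + a%:P * 'X + b%:P * 'X^2)^`() = a%:P + b%:P * 'X *+ 2.
Proof.
rewrite !mul_polyC !derivD derivC add0r !derivZ derivX derivXn /= expr1.
by rewrite alg_polyC scalerMnr.
Qed.

Lemma quadratic_der0 (R : comNzRingType) (c a b : R) :
  (c%:P + a%:P * 'X + b%:P * 'X^2)^`().[0] = a.
Proof. by rewrite quadratic_deriv !hornerE /=; ring. Qed.

Lemma quadratic_flow (R : comNzRingType) (e d : nat) (x y z : R) :
  (e%:R * x + d%:R * y)%:P + (e%:R * d%:R * z)%:P * 'X *+ 2 =
  e%:R * (x%:P + (0 * x + d%:R * z)%:P * 'X + (0 * d%:R * z)%:P * 'X^2) +
  d%:R * (y%:P + (e%:R * z + 0 * y)%:P * 'X + (e%:R * 0 * z)%:P * 'X^2).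
Proof. by rewrite !(rmorphD, rmorphM, rmorph_nat, rmorph0) /=; ring. Qed.

(** * The flow of an elementary subgroup on a generic matrix *)

(** The coordinate ring enters only through the fact that it is generated by
    the entries of the matrix [Y] ([gen]), the morphism [co] only through its
    values on these entries. *)
Section GenericMatrix.
Variables (K : fieldType) (n : nat) (R : comAlgType K) (Y : 'M[R]_n).
Variables (i j : 'I_n).
Hypothesis ij : i != j.
Hypothesis gen : forall P : R -> Prop, (forall c, P c%:A) ->
  (forall a b, P (Y a b)) -> (forall p q, P p -> P q -> P (p + q)) ->
  (forall p q, P p -> P q -> P (p * q)) -> forall p, P p.

Definition moved_mx : 'M[{poly R}]_n :=
  elem_mx i j 'X *m map_mx polyC Y *m (elem_mx i j 'X)^T.

Lemma moved_mxE a b : moved_mx a b =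
  (Y a b)%:P + ((a == i)%:R * Y j b + (b == i)%:R * Y a j)%:P * 'X
    + ((a == i)%:R * (b == i)%:R * Y j j)%:P * 'X^2.
Proof.
rewrite /moved_mx elem_mx_congrE ![map_mx polyC Y _ _]mxE.
by rewrite !(rmorphD, rmorphM, rmorph_nat) /=; ring.
Qed.

Variable co : {rmorphism R -> {poly R}}.
Hypothesis coC : forall c, co c%:A = c%:A%:P.
Hypothesis coY : forall a b, co (Y a b) = moved_mx a b.

Lemma coaction_start p : flow_start co p.
Proof.
apply: (gen (P := flow_start co)) => [c|a b||].
- by rewrite /flow_start coC hornerC.
- by rewrite /flow_start coY moved_mxE quadratic_start.
- exact: flow_startD.
- exact: flow_startM.
Qed.

Lemma flow_der_entry a b :
  flow_der co (Y a b) = (a == i)%:R * Y j b + (b == i)%:R * Y a j.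
Proof. by rewrite /flow_der coY moved_mxE quadratic_der0. Qed.

Lemma coaction_flow p : flow_eq co p.
Proof.
apply: (gen (P := flow_eq co)) => [c|a b||].
- exact: flow_eqC (coC c).
- rewrite /flow_eq flow_der_entry rmorphD !rmorphM !rmorph_nat !coY.
  rewrite !moved_mxE quadratic_deriv (eq_sym j i) (negbTE ij).
  exact: quadratic_flow.
- exact: flow_eqD.
- by apply: flow_eqM; apply: coaction_start.
Qed.

(** Geometrically, [co] followed by ['X := f] is composition with the map that
    moves a point by the elementary matrix with parameter the value of [f]
    there. *)
Lemma coaction_horner_eval (ev ev' : {rmorphism R -> K}) (B : 'M[K]_n) (f p : R) :
  (forall c, ev c%:A = c) -> (forall c, ev' c%:A = c) ->
  (forall a b, ev (Y a b) = B a b) ->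
  (forall a b, ev' (Y a b) =
     (elem_mx i j (ev f) *m B *m (elem_mx i j (ev f))^T) a b) ->
  ev (co p).[f] = ev' p.
Proof.
move=> evC ev'C evY ev'Y.
apply: (gen (P := fun p => ev (co p).[f] = ev' p)) => [c|a b|p1 p2|p1 p2].
- by rewrite coC hornerC evC ev'C.
- rewrite coY moved_mxE quadratic_horner ev'Y elem_mx_congrE.
  by rewrite !(rmorphD, rmorphM, rmorph_nat, rmorphXn) /= !evY; ring.
- by rewrite rmorphD hornerD !rmorphD /= => -> ->.
- by rewrite rmorphM hornerM !rmorphM /= => -> ->.
Qed.

(** Since [i != j], the action of [1 + t E_ij] does not affect the entry
    [Y j j], and all polynomials in it lie in the kernel of the derivation. *)
Definition diag_poly (q : {poly K}) : R := (map_poly (in_alg R) q).[Y j j].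

Lemma eval_diag_poly (ev : {rmorphism R -> K}) q :
  (forall c, ev c%:A = c) -> ev (diag_poly q) = q.[ev (Y j j)].
Proof.
move=> evC; rewrite /diag_poly -horner_map /= -map_poly_comp.
by rewrite map_poly_id // => c _ /=; apply: evC.
Qed.

Lemma coaction_diag_poly q : co (diag_poly q) = (diag_poly q)%:P.
Proof.
rewrite /diag_poly -!horner_map /= -!map_poly_comp coY moved_mxE.
rewrite (eq_sym j i) (negbTE ij) mulr0n !mul0r !addr0 mul0r addr0.
by congr (_.[_]); apply: eq_map_poly => c; apply: coC.
Qed.

Lemma coaction_diag_exp q : [pchar K] =i pred0 ->
  is_exp (fun p => (1 : K) *: (diag_poly q * flow_der co p))
         (fun p => (co p).[diag_poly q]).
Proof.
move=> charK0; apply: flow_exp => //; first exact: coaction_start.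
  exact: coaction_flow.
exact: flow_derC (coaction_diag_poly q).
Qed.

End GenericMatrix.

(** * Replicas defined by a polynomial in a diagonal entry *)

Section Coaction.
Variables (K : closedFieldType) (n : nat).
Local Notation Y := (generic_symmx K n).
Local Notation O := (coord_ring K n).

Lemma entry_sym (R : Type) (B : 'M[R]_n) a b :
  B^T = B -> entry B (enum_rank (upper_of a b)) = B a b.
Proof.
move=> symB; rewrite /entry enum_rankK /=; case: ifP => //= _.
by rewrite -[in RHS]symB mxE.
Qed.

Lemma upper_of_sym (a b : 'I_n) : upper_of a b = upper_of b a.
Proof.
apply: val_inj => /=; case: (ltngtP a b) => // /val_inj -> //.
Qed.

Lemma generic_sym : Y^T = Y.
Proof. by apply/matrixP => a b; rewrite !mxE upper_of_sym. Qed.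

Lemma entry_generic v : entry Y v = 'X_v.
Proof.
rewrite /entry mxE; congr 'X_ _; apply: (can_inj enum_valK).
rewrite enum_rankK; apply: val_inj => /=.
by case: (enum_val v) => -[a b] /= ->.
Qed.

Lemma coord_ring_ind (P : O -> Prop) : (forall c, P c%:A) ->
  (forall a b, P (Y a b)) -> (forall p q, P p -> P q -> P (p + q)) ->
  (forall p q, P p -> P q -> P (p * q)) -> forall p, P p.
Proof.
move=> PC PY PD PM; apply: mpoly_gen_ind => // [c|v].
  by rewrite -alg_mpolyC.
by rewrite -entry_generic; apply: PY.
Qed.

Definition eval_rmorphism (B : symmx K n) : {rmorphism O -> K} := meval (entry B).

Lemma eval_alg B c : eval_rmorphism B c%:A = c.
Proof. by rewrite alg_mpolyC; apply: mevalC. Qed.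

Lemma eval_generic B a b : eval_rmorphism B (Y a b) = B a b.
Proof. by rewrite mxE; apply: etrans (mevalXU _ _) (entry_sym _ _ (eqP (valP B))). Qed.

Variables (i j : 'I_n).

Lemma moved_generic_sym : (moved_mx Y i j)^T = moved_mx Y i j.
Proof. by rewrite /moved_mx !trmx_mul trmxK map_trmx generic_sym mulmxA. Qed.

Definition coaction_rmorphism : {rmorphism O -> {poly O}} :=
  mmap (polyC \o @mpolyC _ K) (entry (moved_mx Y i j)).

Lemma coaction_alg c : coaction_rmorphism c%:A = (c%:A)%:P.
Proof. by rewrite !alg_mpolyC; apply: mmapC. Qed.

Lemma coaction_generic a b : coaction_rmorphism (Y a b) = moved_mx Y i j a b.
Proof.
rewrite mxE; apply: etrans (mmapX _ _ _) _; rewrite mmap1U.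
exact: entry_sym moved_generic_sym.
Qed.

Hypothesis ij : i != j.
Hypothesis charK0 : [pchar K] =i pred0.

(** The exponential of [diag_poly q] times the derivation, seen on points. *)
Definition replica (q : {poly K}) (B : symmx K n) : symmx K n :=
  congr_act (elem_mx i j q.[B j j]) B.

Definition replica_comorphism (q : {poly K}) (p : O) : O :=
  (coaction_rmorphism p).[diag_poly Y j q].

Lemma replica_comorphismP q : is_comorphism (replica q) (replica_comorphism q).
Proof.
move=> p B.
have evf : eval_rmorphism B (diag_poly Y j q) = q.[B j j].
  by rewrite eval_diag_poly ?eval_generic //; apply: eval_alg.
apply: (@coaction_horner_eval _ _ _ _ i j (@coord_ring_ind) coaction_rmorphism
  _ _ (eval_rmorphism B) (eval_rmorphism (replica q B)) B).
- exact: coaction_alg.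
- exact: coaction_generic.
- exact: eval_alg.
- exact: eval_alg.
- exact: eval_generic.
- by move=> a b; rewrite eval_generic evf.
Qed.

Lemma replica_regular q : regular_map (replica q).
Proof. by move=> p; exists (replica_comorphism q p) => B; apply: replica_comorphismP. Qed.

(** The inverse is obtained with the opposite polynomial because the entry
    [B j j] that determines the parameter is not moved. *)
Lemma replicaK q : cancel (replica q) (replica (- q)).
Proof.
move=> B; apply: val_inj; apply/matrixP => a b /=.
have ji : (j == i) = false by rewrite eq_sym (negbTE ij).
rewrite !elem_mx_congrE ji hornerN mulr0n !(mul0r, addr0).
by case: (a == i); case: (b == i); rewrite ?mulr1n ?mulr0n; ring.
Qed.

Lemma replicaNK q : cancel (replica (- q)) (replica q).
Proof. by move=> B; rewrite -{1}[q]opprK replicaK. Qed.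

Definition replica_aut q : autX K n :=
  AutX (replicaK q) (replicaNK q) (replica_regular q) (replica_regular (- q)).

Lemma replica_aut_Gsym q : Gsym (replica_aut q).
Proof.
apply: generated_base; exists i, j; split=> //; right.
exists (diag_poly Y j q); split.
  apply: (@flow_derC _ _ coaction_rmorphism _ (diag_poly Y j q)).
  apply: (@coaction_diag_poly _ _ _ _ i j ij coaction_rmorphism).
    exact: coaction_alg.
  exact: coaction_generic.
exists 1, (replica_comorphism q); split; last exact: replica_comorphismP.
apply: (@coaction_diag_exp _ _ _ _ i j ij (@coord_ring_ind) coaction_rmorphism) => //.
  exact: coaction_alg.
exact: coaction_generic.
Qed.

End Coaction.

(** * Transvections and the elementary group *)

Section Transvection.
Variables (K : fieldType) (n : nat).
Implicit Types (u v w : 'cV[K]_n) (A B : 'M[K]_n) (P : pred 'I_n) (i j k : 'I_n).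

Definition basis_vec (j : 'I_n) : 'cV[K]_n := delta_mx j 0.
Definition transv u v : 'M[K]_n := 1%:M + u *m v^T.

Lemma elem_transv i j (t : K) : elem_mx i j t = transv (t *: basis_vec i) (basis_vec j).
Proof. by rewrite /transv /elem_mx -scalemxAl trmx_delta mul_delta_mx. Qed.

Lemma basis_vec_mul j u : (basis_vec j)^T *m u = (u j 0)%:M.
Proof.
apply/matrixP => a b; rewrite !ord1 trmx_delta -rowE !mxE mulr1n.
by [].
Qed.

Lemma transv0l v : transv 0 v = 1%:M.
Proof. by rewrite /transv mul0mx addr0. Qed.

Lemma transv0r u : transv u 0 = 1%:M.
Proof. by rewrite /transv trmx0 mulmx0 addr0. Qed.

Lemma transv_tr u v : (transv u v)^T = transv v u.
Proof. by rewrite /transv linearD /= trmx1 trmx_mul trmxK. Qed.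

Lemma transvDl u1 u2 v : v^T *m u2 = 0 ->
  transv u1 v *m transv u2 v = transv (u1 + u2) v.
Proof.
move=> vu; rewrite /transv mulmxDl !mulmxDr !mulmx1 mul1mx mulmxA.
by rewrite -(mulmxA u1 v^T u2) vu mulmx0 mul0mx addr0 mulmxDl -addrA [_ + u1 *m _]addrC.
Qed.

Lemma transv_app u v w : transv u v *m w = w + u *m (v^T *m w).
Proof. by rewrite /transv mulmxDl mul1mx mulmxA. Qed.

Lemma transv_conj A A' u v :
  A *m A' = 1%:M -> A *m transv u v *m A' = transv (A *m u) (A'^T *m v).
Proof.
by move=> AA'; rewrite /transv mulmxDr mulmxDl mulmx1 AA' trmx_mul trmxK !mulmxA.
Qed.

(** The predicate [P] restricts the indices, so that one can operate on a
    lower right block only. *)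
Inductive elementary P : 'M[K]_n -> Prop :=
| elementary1 : elementary P 1%:M
| elementary_elem i j t : i != j -> P i -> P j -> elementary P (elem_mx i j t)
| elementaryM A B : elementary P A -> elementary P B -> elementary P (A *m B).

Lemma sub_elementary P A : elementary P A -> elementary predT A.
Proof. by elim=> [|i j t ij _ _|????? ?]; constructor. Qed.

Lemma elem_mxK i j (t : K) : i != j -> elem_mx i j t *m elem_mx i j (- t) = 1%:M.
Proof.
move=> ij; rewrite !elem_transv transvDl ?scaleNr ?subrr ?transv0l //.
by rewrite basis_vec_mul !mxE eq_sym (negbTE ij) /= mulr0 oppr0 raddf0.
Qed.

Lemma elementary_unit P A : elementary P A -> A \in unitmx.
Proof.
elim=> [|i j t ij _ _|{}A B _ uA _ uB]; first exact: unitmx1.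
  by case: (mulmx1_unit (elem_mxK t ij)).
by rewrite unitmx_mul uA.
Qed.

Lemma mulmx1_invmx A B : A *m B = 1%:M -> invmx A = B.
Proof.
move=> AB; have [uA _] := mulmx1_unit AB.
by rewrite -[LHS]mulmx1 -AB mulKmx.
Qed.

Lemma elementary_invmx P A : elementary P A -> elementary P (invmx A).
Proof.
elim=> [|i j t ij Pi Pj|{}A B elA IHA elB IHB].
- by rewrite invmx1; constructor.
- by rewrite (mulmx1_invmx (elem_mxK t ij)); constructor.
- rewrite (@mulmx1_invmx _ (invmx B *m invmx A)); first by constructor.
  have [uA uB] := (elementary_unit elA, elementary_unit elB).
  by rewrite mulmxA mulmxK // mulmxV.
Qed.

Lemma elem_mx_tr i j (t : K) : (elem_mx i j t)^T = elem_mx j i t.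
Proof. by rewrite /elem_mx linearD /= trmx1 linearZ /= trmx_delta. Qed.

Lemma elementary_tr P A : elementary P A -> elementary P A^T.
Proof.
elim=> [|i j t ij Pi Pj|{}A B _ IHA _ IHB].
- by rewrite trmx1; constructor.
- by rewrite elem_mx_tr; constructor; rewrite // eq_sym.
- by rewrite trmx_mul; constructor.
Qed.

Lemma det_elem_mx i j (t : K) : i != j -> \det (elem_mx i j t) = 1.
Proof.
wlog ji : i j / (j < i)%N.
  move=> H ij; case: (ltngtP j i) => [ji|ji|/val_inj eji]; first exact: H.
    by rewrite -det_tr elem_mx_tr; apply: H; rewrite // eq_sym.
  by rewrite eji eqxx in ij.
move=> ij; rewrite det_trig.
  rewrite big1 // => k _; rewrite !mxE eqxx; have [->|_] := eqVneq k i.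
    by rewrite (negbTE ij) mulr0 addr0.
  by rewrite mulr0 addr0.
apply/is_trig_mxP => a b ab; rewrite !mxE.
rewrite (_ : a == b = false); last by apply/negbTE; rewrite neq_ltn ab.
rewrite add0r; case: eqP => [ea|]; last by rewrite mulr0.
case: eqP => [eb|]; last by rewrite mulr0.
by move: ab; rewrite ea eb ltnNge (ltnW ji).
Qed.

Lemma det_elementary P A : elementary P A -> \det A = 1.
Proof.
elim=> [|i j t ij _ _|{}A B _ IHA _ IHB]; first exact: det1.
  exact: det_elem_mx.
by rewrite det_mulmx IHA IHB mulr1.
Qed.

Lemma vec_sum u : u = \sum_k u k 0 *: basis_vec k.
Proof.
rewrite {1}[u]matrix_sum_delta; apply: eq_bigr => k _.
by rewrite big_ord1.
Qed.

(** The factors [elem_mx k j (u k 0)] commute, and their product is obtained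
    by adding up the vectors [u k 0 *: basis_vec k]. *)
Lemma elementary_transv P u j : u j 0 = 0 -> P j ->
  (forall k, ~~ P k -> u k 0 = 0) -> elementary P (transv u (basis_vec j)).
Proof.
move=> uj Pj uP; pose Q w := elementary P (transv w (basis_vec j)) /\ w j 0 = 0.
suff: Q u by case.
rewrite [u]vec_sum; elim/big_ind: _ => [|w1 w2 [e1 z1] [e2 z2]|k _].
- by split; rewrite ?transv0l ?mxE //; constructor.
- split; last by rewrite mxE z1 z2 addr0.
  by rewrite -transvDl ?basis_vec_mul ?z2 ?raddf0 //; constructor.
- have [->|ukN0] := eqVneq (u k 0) 0.
    by split; rewrite scale0r ?transv0l ?mxE //; constructor.
  have kj : k != j by apply: contraNneq ukN0 => ->; rewrite uj.
  split; last by rewrite !mxE eq_sym (negbTE kj) mulr0.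
  rewrite -elem_transv; constructor => //.
  by apply: contraNT ukN0 => /uP ->.
Qed.

(** With a nonzero coordinate outside [j] one can first turn coordinate [j]
    into [1], and then use it to clear all the others. *)
Lemma elementary_move_off P u (i j : 'I_n) : i != j -> P j -> u i 0 != 0 ->
  (forall k, ~~ P k -> u k 0 = 0) ->
  exists2 A, elementary P A & A *m u = basis_vec j.
Proof.
move=> ij Pj ui uP; have Pi : P i by apply: contraNT ui => /uP ->.
pose t := (1 - u j 0) / u i 0; pose w := elem_mx j i t *m u.
have wE : w = u + (1 - u j 0) *: basis_vec j.
  rewrite /w elem_transv transv_app basis_vec_mul mul_mx_scalar scalerA mulrC.
  by rewrite divfK.
have wj : w j 0 = 1 by rewrite wE !mxE !eqxx mulr1 addrC subrK.
exists (transv (basis_vec j - w) (basis_vec j) *m elem_mx j i t).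
  constructor; last by constructor; rewrite // eq_sym.
  apply: elementary_transv => // [|k Pk]; first by rewrite mxE [(- w) _ _]mxE wj mxE !eqxx subrr.
  have kj : k != j by apply: contraNneq Pk => ->.
  by rewrite wE !mxE (uP k) // (negbTE kj) mulr0 addr0 subrr.
by rewrite -mulmxA -/w transv_app basis_vec_mul wj mulmx1 addrC subrK.
Qed.

Lemma elementary_move P u (i j : 'I_n) : i != j -> P i -> P j -> u != 0 ->
  (forall k, ~~ P k -> u k 0 = 0) ->
  exists2 A, elementary P A & A *m u = basis_vec j.
Proof.
move=> ij Pi Pj u0 uP.
case: (pickP (fun k => (k != j) && (u k 0 != 0))) => [k /andP[kj uk]|uj].
  exact: elementary_move_off kj Pj uk uP.
have uk k : k != j -> u k 0 = 0.
  by move=> kj; have := uj k; rewrite kj /= => /negbFE/eqP.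
have ujN0 : u j 0 != 0.
  apply: contraNneq u0 => uj0; apply/eqP/matrixP => k l; rewrite ord1 mxE.
  by have [->|/uk] := eqVneq k j.
have wE : elem_mx i j 1 *m u = u + u j 0 *: basis_vec i.
  by rewrite elem_transv transv_app basis_vec_mul mul_mx_scalar scale1r.
have [|k Pk|A elA AE] :=
  @elementary_move_off P (elem_mx i j 1 *m u) i j ij Pj.
- by rewrite wE !mxE !eqxx mulr1 (uk i) // add0r.
- have ki : k != i by apply: contraNneq Pk => ->.
  by rewrite wE !mxE (negbTE ki) mulr0 addr0 uP.
- exists (A *m elem_mx i j 1); last by rewrite -mulmxA.
  by constructor => //; constructor.
Qed.

(** Up to conjugation by an elementary product and a scalar, every transvection
    is an elementary matrix: straighten [u] to a basis vector, and then [v] by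
    means of a matrix that fixes this basis vector, which is possible as [v]
    is orthogonal to [u]. *)
Lemma transv_frame u v : (2 <= n)%N -> u != 0 -> v != 0 -> v^T *m u = 0 ->
  exists2 h, elementary predT h & exists j k c,
    [/\ j != k, h *m basis_vec j = u & h^T *m v = c *: basis_vec k].
Proof.
move=> n2 u0 v0 vu.
pose j := Ordinal (ltnW n2); pose i := Ordinal n2.
have [//|A elA AE] := @elementary_move predT u i j isT isT isT u0.
have uA := elementary_unit elA.
pose w := (invmx A)^T *m v.
have wA : A^T *m w = v by rewrite mulmxA -trmx_mul mulVmx // trmx1 mul1mx.
have wj : w j 0 = 0.
  have /(congr1 trmx) : w^T *m basis_vec j = 0.
    by rewrite -AE trmx_mul trmxK mulmxA mulmxKV.
  by rewrite trmx_mul trmxK basis_vec_mul => /matrixP/(_ 0 0); rewrite !mxE mulr1n.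
have wE : (invmx A)^T *m v = w by [].
clearbody w.
have [k wk] : exists k, w k 0 != 0.
  apply/existsP; apply: contraNT v0; rewrite negb_exists => /forallP w0.
  rewrite -wA; apply/eqP; suff -> : w = 0 by rewrite mulmx0.
  by apply/matrixP => k l; rewrite ord1 [RHS]mxE; apply/eqP/negbNE/w0.
have jk : j != k by apply: contraNneq wk => <-; rewrite wj.
pose c := w k 0; pose a := c^-1 *: w - basis_vec k.
have ak : a k 0 = 0 by rewrite !mxE !eqxx mulVf // subrr.
have aj : a j 0 = 0 by rewrite !mxE wj mulr0 (negbTE jk) subrr.
pose C := transv a (basis_vec k).
have elC : elementary predT C by apply: elementary_transv.
have uC := elementary_unit elC.
exists (invmx A *m invmx C^T).
  by constructor; apply: elementary_invmx => //; apply: elementary_tr.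
exists j, k, c; split=> //.
  have : C^T *m basis_vec j = basis_vec j.
    rewrite /C transv_tr transv_app -[a^T *m _]trmxK trmx_mul trmxK basis_vec_mul aj.
    by rewrite raddf0 trmx0 mulmx0 addr0.
  move/(congr1 (mulmx (invmx C^T))); rewrite mulKmx ?unitmx_tr // => jE.
  by rewrite -mulmxA -jE -AE mulKmx.
rewrite trmx_mul -mulmxA wE trmx_inv trmxK.
apply: (canLR (mulKmx uC)).
rewrite /C transv_app basis_vec_mul mul_mx_scalar !mxE !eqxx mulr1.
by rewrite scalerBr scalerA mulfV // scale1r addrC subrK.
Qed.

End Transvection.

(** * Quadratic forms of symmetric matrices *)

Section QuadraticForm.
Variables (K : fieldType) (n : nat).
Implicit Types (u v w : 'cV[K]_n) (A B : 'M[K]_n).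

Definition quad v B : K := (v^T *m B *m v) 0 0.

Lemma quad_congr v A B : quad v (A *m B *m A^T) = quad (A^T *m v) B.
Proof. by rewrite /quad trmx_mul trmxK !mulmxA. Qed.

Lemma quadZ a v B : quad (a *: v) B = a ^+ 2 * quad v B.
Proof.
by rewrite /quad -scalemxAr [(a *: v)^T]linearZ /= -!scalemxAl scalerA mxE expr2.
Qed.

Lemma quad_std k B : quad (basis_vec K k) B = B k k.
Proof. by rewrite /quad trmx_delta -rowE -colE !mxE. Qed.

Lemma quadB v A B : quad v (A - B) = quad v A - quad v B.
Proof. by rewrite /quad mulmxBr mulmxBl !mxE. Qed.

Definition bil u v B : K := (u^T *m B *m v) 0 0.

Lemma quadD u v B : B^T = B ->
  quad (u + v) B = quad u B + bil u v B *+ 2 + quad v B.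
Proof.
move=> symB; have vu : bil v u B = bil u v B.
  have -> : bil v u B = (u^T *m B *m v)^T 0 0.
    by rewrite !trmx_mul trmxK symB mulmxA.
  by rewrite mxE.
have mxD (M N : 'M[K]_1) : (M + N) 0 0 = M 0 0 + N 0 0 by rewrite mxE.
rewrite /quad [(u + v)^T]linearD /= !mulmxDl !mulmxDr !mxD -/(bil u v B) -/(bil v u B) vu.
by rewrite -!/(quad _ _); ring.
Qed.

Lemma bil_std i j B : bil (basis_vec K i) (basis_vec K j) B = B i j.
Proof. by rewrite /bil trmx_delta -rowE -colE !mxE. Qed.

Lemma bilZr a u v B : bil u (a *: v) B = a * bil u v B.
Proof. by rewrite /bil -scalemxAr mxE. Qed.

(** Polarization: one of [e_i], [e_j] and [e_i + e_j] works. *)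
Lemma quad_nonzero_supp (P : pred 'I_n) B i j : 2%:R != 0 :> K -> B^T = B ->
  P i -> P j -> B i j != 0 ->
  exists2 v : 'cV[K]_n, (forall k, ~~ P k -> v k 0 = 0) & quad v B != 0.
Proof.
move=> two symB Pi Pj Bij.
have suppE k l : P k -> ~~ P l -> basis_vec K k l 0 = 0.
  by move=> Pk Pl; rewrite mxE; case: eqP => // elk; rewrite elk Pk in Pl.
have [Bii|Bii] := eqVneq (B i i) 0; last first.
  by exists (basis_vec K i); [move=> k; apply: suppE | rewrite quad_std].
have [Bjj|Bjj] := eqVneq (B j j) 0; last first.
  by exists (basis_vec K j); [move=> k; apply: suppE | rewrite quad_std].
exists (basis_vec K i + basis_vec K j) => [k Pk|].
  by rewrite mxE !suppE // addr0.
rewrite quadD // !quad_std Bii Bjj bil_std add0r addr0 -mulr_natr.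
by rewrite mulf_neq0.
Qed.

Lemma quad_nonzero B : 2%:R != 0 :> K -> B^T = B -> B != 0 -> exists v, quad v B != 0.
Proof.
move=> two symB B0.
case: (pickP (fun ij : 'I_n * 'I_n => B ij.1 ij.2 != 0)) => [[i j] /= Bij|Bz].
  by have [v _ qv] := @quad_nonzero_supp predT B i j two symB isT isT Bij; exists v.
case/eqP: B0; apply/matrixP => i j; rewrite mxE.
by have /negbFE/eqP := Bz (i, j).
Qed.

End QuadraticForm.

(** * Generic conditions on a vector space *)

Section Generic.
Variables (K : closedFieldType) (V : lmodType K).
Implicit Types (f g : V -> K).

(** A form of polynomiality without coordinates. It suffices for combining
    nonvanishing conditions, which is done on a line through two points. *)
Definition poly_on_lines f := forall a b, exists p : {poly K}, forall t, f (a + t *: b) = p.[t].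

Lemma poly_on_lines_cst c : poly_on_lines (fun=> c).
Proof. by move=> a b; exists c%:P => t; rewrite hornerC. Qed.

Lemma poly_on_linesD f g : poly_on_lines f -> poly_on_lines g ->
  poly_on_lines (fun x => f x + g x).
Proof.
move=> Pf Pg a b; have [[p pE] [q qE]] := (Pf a b, Pg a b).
by exists (p + q) => t; rewrite hornerD pE qE.
Qed.

Lemma poly_on_linesM f g : poly_on_lines f -> poly_on_lines g ->
  poly_on_lines (fun x => f x * g x).
Proof.
move=> Pf Pg a b; have [[p pE] [q qE]] := (Pf a b, Pg a b).
by exists (p * q) => t; rewrite hornerM pE qE.
Qed.

Definition generic (D : V -> Prop) : Prop :=
  exists f, [/\ poly_on_lines f, exists x, f x != 0 & forall x, f x != 0 -> D x].

Lemma generic_neq0 f x : poly_on_lines f -> f x != 0 -> generic (fun y => f y != 0).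
Proof. by move=> Pf fx; exists f; split=> //; exists x. Qed.

Lemma generic_exists D : generic D -> exists x, D x.
Proof. by case=> f [_ [x fx] fD]; exists x; apply: fD. Qed.

(** On the line joining a point where [f] does not vanish to one where [g] does
    not, [f * g] is a nonzero polynomial, which has a nonroot since the field
    is infinite. *)
Lemma generic_and (D E : V -> Prop) : generic D -> generic E -> generic (fun x => D x /\ E x).
Proof.
move=> [f [Pf [a fa] fD]] [g [Pg [b gb] gE]].
exists (fun x => f x * g x); split; first exact: poly_on_linesM.
  have [[p pE] [q qE]] := (Pf a (b - a), Pg a (b - a)).
  have p0 : p != 0.
    by apply: contraNneq fa => p0; move: (pE 0); rewrite scale0r addr0 p0 horner0 => ->.
  have q0 : q != 0.
    apply: contraNneq gb => q0; move: (qE 1).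
    by rewrite scale1r addrC subrK q0 horner0 => ->.
  have /closed_nonrootP[t] := mulf_neq0 p0 q0.
  by rewrite /root hornerM -pE -qE; exists (a + t *: (b - a)).
by move=> x; rewrite mulf_eq0 => /norP[/fD Dx /gE Ex].
Qed.

Lemma generic_all (I : eqType) (s : seq I) (D : I -> V -> Prop) :
  (forall i, i \in s -> generic (D i)) -> generic (fun x => forall i, i \in s -> D i x).
Proof.
elim: s => [_|i s IHs Ds].
  exists (fun=> 1); split=> //; first exact: poly_on_lines_cst.
  by exists 0; rewrite oner_neq0.
have [|f [Pf f0 fD]] := generic_and (Ds i (mem_head _ _)) (IHs _).
  by move=> k ks; apply: Ds; rewrite inE ks orbT.
exists f; split=> // x /fD[Dx Dsx] k; rewrite inE => /orP[/eqP -> //|].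
exact: Dsx.
Qed.

Definition mx_poly_on_lines m p (F : V -> 'M[K]_(m, p)) :=
  forall i j, poly_on_lines (fun x => F x i j).

Lemma mx_poly_cst m p (A : 'M[K]_(m, p)) : mx_poly_on_lines (fun=> A).
Proof. by move=> i j; apply: poly_on_lines_cst. Qed.

Lemma poly_on_lines_ext f g : f =1 g -> poly_on_lines f -> poly_on_lines g.
Proof. by move=> fg Pf a b; have [p pE] := Pf a b; exists p => t; rewrite -fg. Qed.

Lemma poly_on_lines_sum (I : finType) (f : I -> V -> K) :
  (forall k, poly_on_lines (f k)) -> poly_on_lines (fun x => \sum_k f k x).
Proof.
move=> Pf; elim: (index_enum I) => [|k r IHr].
  by apply: poly_on_lines_ext (poly_on_lines_cst 0) => x; rewrite big_nil.
by apply: poly_on_lines_ext (poly_on_linesD (Pf k) IHr) => x; rewrite big_cons.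
Qed.

Lemma mx_poly_mul m p q (F : V -> 'M[K]_(m, p)) (G : V -> 'M[K]_(p, q)) :
  mx_poly_on_lines F -> mx_poly_on_lines G -> mx_poly_on_lines (fun x => F x *m G x).
Proof.
move=> PF PG i j; apply: (@poly_on_lines_ext (fun x => \sum_k F x i k * G x k j)).
  by move=> x; rewrite mxE.
apply: poly_on_lines_sum => k; exact: poly_on_linesM.
Qed.

Lemma mx_poly_tr m p (F : V -> 'M[K]_(m, p)) :
  mx_poly_on_lines F -> mx_poly_on_lines (fun x => (F x)^T).
Proof. by move=> PF i j; apply: poly_on_lines_ext (PF j i) => x; rewrite mxE. Qed.

Lemma mx_polyD m p (F G : V -> 'M[K]_(m, p)) :
  mx_poly_on_lines F -> mx_poly_on_lines G -> mx_poly_on_lines (fun x => F x + G x).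
Proof.
move=> PF PG i j; apply: poly_on_lines_ext (poly_on_linesD (PF i j) (PG i j)) => x.
by rewrite mxE.
Qed.

Lemma poly_on_lines_quad n (F : V -> 'cV[K]_n) (B : 'M[K]_n) :
  mx_poly_on_lines F -> poly_on_lines (fun x => quad (F x) B).
Proof.
move=> PF; apply: (mx_poly_mul (mx_poly_mul (mx_poly_tr PF) (mx_poly_cst B)) PF).
Qed.

End Generic.

(** * Moving one point while fixing others *)

Lemma interpolate (F : fieldType) (s : seq F) a : a \notin s ->
  exists2 p : {poly F}, p.[a] = 1 & {in s, forall z, p.[z] = 0}.
Proof.
move=> aNs; pose P := \prod_(c <- s) ('X - c%:P).
have Pa : P.[a] != 0 by rewrite -rootE root_prod_XsubC.
exists (P.[a]^-1 *: P) => [|z zs]; first by rewrite hornerZ mulVf.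
rewrite hornerZ (_ : P.[z] = 0) ?mulr0 //.
by apply/rootP; rewrite root_prod_XsubC.
Qed.

Section Moves.
Variables (K : closedFieldType) (n : nat).
Hypothesis charK0 : [pchar K] =i pred0.
Hypothesis n_ge2 : (2 <= n)%N.
Implicit Types (B x y z : symmx K n) (A g h : 'M[K]_n) (u v w : 'cV[K]_n).

Lemma congr_act1 B : congr_act 1%:M B = B.
Proof. by apply: val_inj; rewrite /= mul1mx trmx1 mulmx1. Qed.

Lemma congr_actM A A' B : congr_act A (congr_act A' B) = congr_act (A *m A') B.
Proof. by apply: val_inj; rewrite /= trmx_mul !mulmxA. Qed.

Lemma congr_actK A B : A \in unitmx -> congr_act (invmx A) (congr_act A B) = B.
Proof. by move=> uA; rewrite congr_actM mulVmx // congr_act1. Qed.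

Lemma congr_actKV A B : A \in unitmx -> congr_act A (congr_act (invmx A) B) = B.
Proof. by move=> uA; rewrite congr_actM mulmxV // congr_act1. Qed.

(** The maps induced by the group of automorphisms are studied as plain
    functions. Besides membership one remembers that points stay in their orbit
    under the elementary group, which keeps rank and determinant. *)
Definition sym_move (phi : symmx K n -> symmx K n) : Prop :=
  (exists2 g : autX K n, Gsym g & g =1 phi) /\
  (forall B, exists2 A, elementary predT A & phi B = congr_act A B).

Lemma eq_sym_move phi psi : phi =1 psi -> sym_move phi -> sym_move psi.
Proof.
move=> e [[g Gg gE] orb]; split; first by exists g => // B; rewrite gE e.
by move=> B; have [A elA AE] := orb B; exists A; rewrite -?e.
Qed.

Lemma sym_move_id : sym_move id.
Proof.
split; first by exists (aut_id K n) => //; apply: generated_id.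
by move=> B; exists 1%:M; [constructor | rewrite congr_act1].
Qed.

Lemma sym_move_comp phi psi : sym_move phi -> sym_move psi -> sym_move (phi \o psi).
Proof.
move=> [[g Gg gE] orbg] [[h Gh hE] orbh]; split.
  by exists (aut_comp g h) => [|B /=]; [apply: generated_comp | rewrite hE gE].
move=> B; have [A elA AE] := orbh B; have [A' elA' A'E] := orbg (psi B).
by exists (A' *m A); [constructor | rewrite /= A'E AE congr_actM].
Qed.

Lemma sym_move_replica (i j : 'I_n) (q : {poly K}) : i != j -> sym_move (replica i j q).
Proof.
move=> ij; split.
  by exists (replica_aut ij q) => //; apply: replica_aut_Gsym.
by move=> B; exists (elem_mx i j q.[B j j]) => //; constructor.
Qed.

Lemma sym_move_congr A : elementary predT A -> sym_move (congr_act A).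
Proof.
elim=> [|i j t ij _ _|{}A A' _ IHA _ IHA'].
- by apply: eq_sym_move sym_move_id => B; rewrite congr_act1.
- apply: eq_sym_move (sym_move_replica t%:P ij) => B.
  by rewrite /replica hornerC.
- by apply: eq_sym_move (sym_move_comp IHA IHA') => B; rewrite /= congr_actM.
Qed.

(** The form [quad v] is invariant under [transv u v] when [v] is orthogonal to
    [u], so the parameter of the transvection may depend on it. By
    [transv_frame] the map is conjugate to a replica of an elementary subgroup,
    [quad v] becoming a multiple of the diagonal entry at [k]. *)
Lemma sym_move_transv u v (p : {poly K}) : v^T *m u = 0 ->
  sym_move (fun B => congr_act (transv (p.[quad v B] *: u) v) B).
Proof.
move=> vu; have [->|u0] := eqVneq u 0.
  by apply: eq_sym_move sym_move_id => B; rewrite scaler0 transv0l congr_act1.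
have [->|v0] := eqVneq v 0.
  by apply: eq_sym_move sym_move_id => B; rewrite transv0r congr_act1.
have [h elh [j [k [c [jk hj hv]]]]] := transv_frame n_ge2 u0 v0 vu.
have uh := elementary_unit elh.
pose q := c *: (p \Po (c ^+ 2 *: 'X)).
have := sym_move_comp (sym_move_congr elh)
  (sym_move_comp (sym_move_replica q jk) (sym_move_congr (elementary_invmx elh))).
apply: eq_sym_move => B; rewrite /= /replica !congr_actM; congr congr_act.
have -> : quad v B = c ^+ 2 * (congr_act (invmx h) B) k k.
  by rewrite -quad_std -quadZ -hv -quad_congr -[in LHS](congr_actKV B uh).
have -> : v = c *: ((invmx h)^T *m basis_vec K k).
  by rewrite scalemxAr -hv mulmxA -trmx_mul mulmxV // trmx1 mul1mx.
rewrite /q hornerZ horner_comp hornerZ hornerX elem_transv.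
rewrite transv_conj ?mulmxV // -hj -scalemxAr mulrC -scalerA /transv.
by rewrite -!scalemxAl [(c *: _)^T]linearZ /= -scalemxAr !scalerA mulrC.
Qed.

Definition linked (F : seq (symmx K n)) x y : Prop :=
  exists phi, [/\ sym_move phi, {in F, forall z, phi z = z} & phi x = y].

Lemma linked_refl F x : linked F x x.
Proof. by exists id; split=> //; apply: sym_move_id. Qed.

Lemma linked_trans F x y z : linked F x y -> linked F y z -> linked F x z.
Proof.
move=> [phi [mphi fixphi <-]] [psi [mpsi fixpsi <-]].
exists (psi \o phi); split=> [|t tF|] //; first exact: sym_move_comp.
by rewrite /= fixphi ?fixpsi.
Qed.

(** The basic step: when [quad v] separates [x] from [F], interpolation gives a
    replica that acts at [x] as the transvection and at the points of [F] as
    the identity. *)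
Lemma linked_transv F x u v : v^T *m u = 0 ->
  {in F, forall z, quad v x != quad v z} -> linked F x (congr_act (transv u v) x).
Proof.
move=> vu sep.
have [|p p1 p0] := @interpolate K [seq quad v (symval z) | z <- F] (quad v x).
  by apply/mapP => -[z zF /eqP]; rewrite (negbTE (sep z zF)).
exists (fun B => congr_act (transv (p.[quad v B] *: u) v) B); split=> [|z zF|].
- exact: sym_move_transv.
- by rewrite p0 ?scale0r ?transv0l ?congr_act1 //; apply: map_f.
- by rewrite p1 scale1r.
Qed.

(** The obstructions met by a word in elementary matrices at the successive
    points of the path are conditions on the values of finitely many quadratic
    forms at the starting point: the form [basis_vec j] used by one factor is
    pulled back along the factors that come before it. *)
Lemma elementary_avoid F A : elementary predT A ->
  exists2 L : seq ('cV[K]_n * K), {in L, forall wc, wc.1 != 0} &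
    forall y, {in L, forall wc, quad wc.1 y != wc.2} -> linked F y (congr_act A y).
Proof.
elim=> [|i j t ij _ _|{}A A' elA [L L0 LP] elA' [L' L'0 L'P]].
- by exists [::] => // y _; rewrite congr_act1; apply: linked_refl.
- exists [seq (basis_vec K j, quad (basis_vec K j) (symval z)) | z <- F].
    move=> _ /mapP[z _ ->] /=; apply/eqP => /matrixP/(_ j 0)/eqP.
    by rewrite !mxE !eqxx oner_eq0.
  move=> y sep; rewrite elem_transv; apply: linked_transv.
    by rewrite -scalemxAr basis_vec_mul mxE (negbTE (_ : j != i)) 1?eq_sym // raddf0 scaler0.
  by move=> z zF; apply: (sep (_, _)); apply: (map_f (fun z => (_, _))).
- exists (L' ++ [seq (A'^T *m wc.1, wc.2) | wc <- L]).
    move=> wc; rewrite mem_cat => /orP[/L'0 //|/mapP[{}wc wcL ->]] /=.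
    apply: contraNneq (L0 _ wcL) => e0.
    have uA' : A'^T \in unitmx by rewrite unitmx_tr (elementary_unit elA').
    by rewrite -(mulKmx uA' wc.1) e0 mulmx0.
  move=> y sep; rewrite -congr_actM; apply: linked_trans (L'P y _) (LP _ _).
    by move=> wc wcL'; apply: sep; rewrite mem_cat wcL'.
  move=> wc wcL /=; rewrite quad_congr.
  by apply: (sep (_, _)); rewrite mem_cat (map_f (fun wc => (_, _))) ?orbT.
Qed.

Local Notation V := ('M[K]_n * 'cV[K]_n)%type.
(** A skew-symmetric matrix applied to [v] yields a vector orthogonal to [v],
    so pairs [(S, v)] in a vector space parametrize pairs [(u, v)] with
    [v^T u = 0]. *)
Definition skew_apply (a : V) : 'cV[K]_n := (a.1 - a.1^T) *m a.2.

Lemma skew_apply_orth (a : V) : 2%:R != 0 :> K -> a.2^T *m skew_apply a = 0.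
Proof.
move=> two; apply/matrixP => i j; rewrite !ord1 [RHS]mxE.
pose X := a.2^T *m skew_apply a; have XT : X^T = - X.
  rewrite /X /skew_apply !trmx_mul trmxK [(_ - _)^T]linearB /= trmxK -mulmxN -mulNmx.
  by rewrite opprB mulmxA.
have /matrixP/(_ 0 0)/eqP := XT; rewrite !mxE -addr_eq0 -mulr2n -mulr_natr.
by rewrite mulf_eq0 (negbTE two) orbF => /eqP.
Qed.

Lemma snd_poly : mx_poly_on_lines (fun a : V => a.2).
Proof.
move=> i j a b; exists ((a.2 i j)%:P + (b.2 i j)%:P * 'X) => t.
by rewrite /= !mxE !hornerE mulrC.
Qed.

Lemma skew_apply_poly : mx_poly_on_lines skew_apply.
Proof.
apply: mx_poly_mul snd_poly => i j a b.
exists ((a.1 i j - a.1 j i)%:P + (b.1 i j - b.1 j i)%:P * 'X) => t.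
by rewrite /= !mxE !hornerE; ring.
Qed.

Lemma generic_skew_orth w : w != 0 -> 
  generic (fun a : V => ((skew_apply a)^T *m w) 0 0 != 0).
Proof.
move=> w0; have [i wi] : exists i, w i 0 != 0.
  case: (pickP (fun i => w i 0 != 0)) => [i wi|wz]; first by exists i.
  case/eqP: w0; apply/matrixP => i j; rewrite ord1 [RHS]mxE.
  by have /negbFE/eqP := wz i.
have [j ij] : exists j, j != i.
  have [->|] := eqVneq i (Ordinal (ltnW n_ge2)); first by exists (Ordinal n_ge2).
  by rewrite eq_sym; exists (Ordinal (ltnW n_ge2)).
apply: (@generic_neq0 _ _ _ (delta_mx i j, basis_vec K j)).
  exact: (mx_poly_mul (mx_poly_tr skew_apply_poly) (mx_poly_cst w)).
rewrite /skew_apply /= trmx_delta mulmxBl !mul_delta_mx_cond eqxx (eq_sym i j) (negbTE ij).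
by rewrite mulr0n subr0 mulr1n basis_vec_mul mxE mulr1n.
Qed.

Lemma char_two : 2%:R != 0 :> K.
Proof. by rewrite ((pcharf0P K).1 charK0). Qed.

Lemma symK x : (symval x)^T = x.
Proof. exact/eqP/(valP x). Qed.

Lemma generic_quad x : symval x != 0 -> generic (fun a : V => quad a.2 x != 0).
Proof.
move=> x0; have [v qv] := quad_nonzero char_two (symK x) x0.
exact: (@generic_neq0 _ _ _ (0, v) (poly_on_lines_quad (symval x) snd_poly) qv).
Qed.

Lemma generic_quad_neq x y : x != y -> generic (fun a : V => quad a.2 x != quad a.2 y).
Proof.
move=> xy; have [||v qv] := @quad_nonzero K n (symval x - symval y) char_two.
- by rewrite linearB /= !symK.
- by rewrite subr_eq0.
have [f [Pf f0 fD]] := @generic_neq0 _ _ _ (0, v)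
  (poly_on_lines_quad (symval x - symval y) snd_poly) qv.
by exists f; split=> // a /fD; rewrite quadB subr_eq0.
Qed.

(** If [u] is replaced by [s u], the value becomes a polynomial in [s] with
    leading term [s^2 (u^T w)^2 (quad v x)], generically nonzero, so it does
    not stay equal to [c]. *)
Lemma generic_moved_quad x w c : symval x != 0 -> w != 0 ->
  generic (fun a : V => quad w (congr_act (transv (skew_apply a) a.2) x) != c).
Proof.
move=> x0 w0.
pose f (a : V) := quad (w + a.2 *m ((skew_apply a)^T *m w)) x + - c.
have Pf : poly_on_lines f.
  apply: (@poly_on_linesD _ _ (fun a : V => quad _ x) (fun=> - c));
    last exact: poly_on_lines_cst.
  apply: poly_on_lines_quad.
  apply: mx_polyD (mx_poly_cst w) _; apply: mx_poly_mul snd_poly _.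
  exact: mx_poly_mul (mx_poly_tr skew_apply_poly) (mx_poly_cst w).
have [a [/= uw qv]] := generic_exists (generic_and (generic_skew_orth w0) (generic_quad x0)).
pose d := ((skew_apply a)^T *m w) 0 0.
have fE s : f (s *: a.1, a.2) = 
    quad w x + bil w a.2 x * (s * d) *+ 2 + (s * d) ^+ 2 * quad a.2 x - c.
  rewrite /f /=; have -> : skew_apply (s *: a.1, a.2) = s *: skew_apply a.
    by rewrite /skew_apply /= linearZ /= -scalerBr scalemxAl.
  rewrite linearZ /= -scalemxAl -scalemxAr [_ *m w]mx11_scalar -/d mul_mx_scalar.
  by rewrite scalerA quadD ?symK // quadZ bilZr; ring.
have [s fs] : exists s, f (s *: a.1, a.2) != 0.
  have [f0|] := eqVneq (f (0 *: a.1, a.2)) 0; last by exists 0.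
  have [f1|] := eqVneq (f (1 *: a.1, a.2)) 0; last by exists 1.
  have [fm|] := eqVneq (f ((-1) *: a.1, a.2)) 0; last by exists (-1).
  (* The second difference of a quadratic polynomial at -1, 0, 1 is twice its
     leading coefficient. *)
  have : 2%:R * (d ^+ 2 * quad a.2 x) == 0.
    apply/eqP; transitivity (f (1 *: a.1, a.2) + f ((-1) *: a.1, a.2)
                             - 2%:R * f (0 *: a.1, a.2)).
      by rewrite !fE; ring.
    by rewrite f0 f1 fm; ring.
  by rewrite !mulf_eq0 (negbTE char_two) (negbTE qv) (negbTE uw).
have [F [PF F0 FD]] := generic_neq0 Pf fs.
exists F; split=> // b /FD; rewrite /f subr_eq0 quad_congr transv_tr transv_app.
by [].
Qed.

(** The points met on the way from [x] to [g x] may lie in [F] or fail to be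
    separated from it. A detour by a generic transvection [s] cures this: go
    from [x] to [s x], then to [g s x] by the word for [g], and come back with
    the transvection [g s^-1 g^-1]. In the last step [v] is replaced by
    [g^-T v], so that it is enough that [quad v] separates [x] from the points
    [g^-1 z], [z] in [F]. *)
Lemma linked_elementary F x g : elementary predT g -> x \notin F ->
  congr_act g x \notin F -> linked F x (congr_act g x).
Proof.
move=> elg xF yF; have ug := elementary_unit elg.
have [x0|x0] := eqVneq (symval x) 0.
  suff -> : congr_act g x = x by apply: linked_refl.
  by apply: val_inj; rewrite /= x0 mulmx0 mul0mx.
have [L L0 LP] := elementary_avoid F elg.
have gNx z : z \in F -> congr_act (invmx g) z != x.
  move=> zF; apply: contraNneq yF => <-.
  by rewrite congr_actKV.
have /generic_exists[a [[s1 s2] s3]] := generic_and (generic_and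
  (@generic_all _ _ _ F (fun z a => quad a.2 z != quad a.2 x)
     (fun z zF => generic_quad_neq (memPn xF z zF)))
  (@generic_all _ _ _ F (fun z a => quad a.2 (congr_act (invmx g) z) != quad a.2 x)
     (fun z zF => generic_quad_neq (gNx z zF))))
  (@generic_all _ _ _ L _ (fun wc wcL => generic_moved_quad wc.2 x0 (L0 wc wcL))).
pose u := skew_apply a; pose v := a.2.
have vu : v^T *m u = 0 := skew_apply_orth a char_two.
have uv : u^T *m v = 0 by rewrite -[LHS]trmxK trmx_mul trmxK vu trmx0.
pose x1 := congr_act (transv u v) x.
have xx1 : linked F x x1.
  by apply: linked_transv vu _ => z zF; rewrite eq_sym; apply: s1.
apply: linked_trans xx1 (linked_trans (LP x1 s3) _).
pose v' := (invmx g)^T *m v.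
have sKs : transv (- u) v *m transv u v = 1%:M.
  by rewrite transvDl // addNr transv0l.
have -> : congr_act g x = congr_act (transv (g *m - u) v') (congr_act g x1).
  rewrite /v' -transv_conj ?mulmxV // !congr_actM -!mulmxA mulKmx //.
  by rewrite sKs mulmx1.
apply: linked_transv.
  by rewrite /v' trmx_mul trmxK mulmxA mulmxKV // mulmxN vu oppr0.
have gv' : g^T *m v' = v by rewrite /v' mulmxA -trmx_mul mulVmx // trmx1 mul1mx.
move=> z zF; rewrite quad_congr gv' quad_congr transv_tr transv_app uv mulmx0 addr0.
by rewrite -[z](congr_actKV _ ug) quad_congr gv' eq_sym; apply: s2.
Qed.

End Moves.

(** * Symmetric matrices up to elementary congruence *)

Section NormalForm.
Variables (K : closedFieldType) (n : nat).
Hypothesis two : 2%:R != 0 :> K.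
Implicit Types (A B : 'M[K]_n) (v : 'cV[K]_n).

(** The first [k] steps of the diagonalization are done. *)
Definition reduced (k : nat) B : Prop := forall i j : 'I_n, (i < k)%N -> B i j = (i == j)%:R.

Definition from (k : nat) : pred 'I_n := fun i => (k <= i)%N.

Lemma transv_std_mull u k B p q :
  (transv u (basis_vec K k) *m B) p q = B p q + u p 0 * B k q.
Proof.
rewrite /transv mulmxDl mul1mx -mulmxA trmx_delta -rowE mxE; congr (_ + _).
by rewrite mxE big_ord1 [row _ _ _ _]mxE.
Qed.

Lemma transv_congrE u k B p q :
  (transv u (basis_vec K k) *m B *m (transv u (basis_vec K k))^T) p q =
  B p q + u p 0 * B k q + u q 0 * B p k + u p 0 * u q 0 * B k k.
Proof.
have -> : transv u (basis_vec K k) *m B *m (transv u (basis_vec K k))^T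
        = (transv u (basis_vec K k) *m (transv u (basis_vec K k) *m B)^T)^T.
  by rewrite trmx_mul trmxK.
by rewrite [LHS]mxE transv_std_mull ![_^T _ _]mxE !transv_std_mull; ring.
Qed.

Lemma congr_sym A B : B^T = B -> (A *m B *m A^T)^T = A *m B *m A^T.
Proof. by move=> symB; rewrite !trmx_mul trmxK symB mulmxA. Qed.

Lemma reduced_congr k A B : elementary (from k) A -> reduced k B ->
  reduced k (A *m B *m A^T).
Proof.
move=> elA; elim: elA B => [|i j t ij ki kj|{}A A' _ IHA _ IHA'] B redB.
- by rewrite mul1mx trmx1 mulmx1.
- move=> a b ak; have ai : a == i = false.
    by apply: contraTF ak => /eqP ->; rewrite -leqNgt.
  have aj : a == j = false by apply: contraTF ak => /eqP ->; rewrite -leqNgt.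
  by rewrite elem_mx_congrE ai !(redB a) // aj !(mulr0n, mul0r, mulr0, addr0).
- by rewrite trmx_mul mulmxA -(mulmxA A) -(mulmxA A); apply/IHA/IHA'.
Qed.

Lemma closed_sqrt (a : K) : exists c, c ^+ 2 = a.
Proof.
have /closed_rootP[c /rootP] : size ('X^2 - a%:P) != 1%N by rewrite size_XnsubC.
by rewrite !hornerE => /eqP; rewrite subr_eq0 => /eqP; exists c.
Qed.

(** Lagrange's step. A vector [v] supported on the remaining indices with
    [quad v B = 1] exists as soon as the remaining block is nonzero; an
    elementary product makes it the basis vector [k], for which at least two
    remaining indices are needed, hence [k.+1 < n]. Pivoting on the entry [1]
    clears the rest of row and column [k]. *)
Lemma reduced_step k B (i j : 'I_n) : (k.+1 < n)%N -> B^T = B -> reduced k B ->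
  (k <= i)%N -> (k <= j)%N -> B i j != 0 ->
  exists2 A, elementary predT A & reduced k.+1 (A *m B *m A^T).
Proof.
move=> kn symB redB ki kj Bij.
pose k0 := Ordinal (ltnW kn); pose k1 := Ordinal kn.
have [v vP qv] := @quad_nonzero_supp _ _ (from k) B i j two symB ki kj Bij.
have [c cE] := closed_sqrt (quad v B)^-1.
have q1 : quad (c *: v) B = 1 by rewrite quadZ cE mulVf.
have cv0 : c *: v != 0.
  by apply: contra_eq_neq q1 => ->; rewrite /quad mulmx0 mxE eq_sym oner_eq0.
have [||||l kl|A elA AE] := @elementary_move _ _ (from k) (c *: v) k1 k0.
- by rewrite -val_eqE /= gtn_eqF.
- exact: leqnSn.
- exact: leqnn.
- exact: cv0.
- by rewrite mxE vP // mulr0.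
have uA := elementary_unit elA.
pose C := (invmx A)^T.
have elC : elementary (from k) C by apply/elementary_tr/elementary_invmx.
pose B1 := C *m B *m C^T.
have symB1 : B1^T = B1 by apply: congr_sym.
have red1 : reduced k B1 by apply: reduced_congr.
have B1k : B1 k0 k0 = 1 by rewrite -quad_std quad_congr trmxK -AE mulKmx.
pose a : 'cV[K]_n := \col_l (- (l != k0)%:R * B1 l k0).
have elD : elementary predT (transv a (basis_vec K k0)).
  by apply: elementary_transv => //; rewrite mxE eqxx oppr0 mul0r.
exists (transv a (basis_vec K k0) *m C).
  by constructor => //; apply: sub_elementary elC.
rewrite trmx_mul mulmxA -(mulmxA (transv _ _)) -(mulmxA (transv _ _)) -/B1.
clearbody B1.
move=> p q; rewrite ltnS leq_eqVlt => /orP[/eqP pk|pk]; rewrite transv_congrE.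
  have -> : p = k0 by apply: val_inj.
  rewrite !mxE eqxx B1k (_ : B1 q k0 = B1 k0 q); last by rewrite -{1}symB1 mxE.
  have [->|qk] := eqVneq q k0; first by rewrite B1k /=; ring.
  by rewrite /=; ring.
have pk0 : p == k0 = false by rewrite -val_eqE /= ltn_eqF.
by rewrite !mxE !(red1 p) // pk0 /=; ring.
Qed.

Definition last_diag (b : K) : 'M[K]_n := diag_mx (\row_i if i.+1 == n then b else 1).

(** The last index has no partner to be rescaled with, so that its coefficient,
    if nonzero, is the determinant. *)
Definition normal_form B : Prop :=
  (exists2 k, (k < n)%N & B = pid_mx k) \/ (exists2 b, b != 0 & B = last_diag b).

Lemma reduced_normal_form m k B : (0 < n)%N -> (k + m)%N = n.-1 -> B^T = B -> reduced k B ->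
  exists2 A, elementary predT A & normal_form (A *m B *m A^T).
Proof.
move=> n0; elim: m k B => [|m IHm] k B km symB redB.
  have kn : (k < n)%N by rewrite addn0 in km; rewrite km prednK.
  exists 1%:M; first by constructor.
  rewrite mul1mx trmx1 mulmx1; pose l := Ordinal kn.
  have lE (i : 'I_n) : ~~ (i < k)%N -> i = l.
    rewrite -leqNgt => ki; apply: val_inj; apply/eqP; rewrite eqn_leq ki andbT.
    by rewrite /= -ltnS -[k]addn0 km prednK.
  have [b0|b0] := eqVneq (B l l) 0.
    left; exists k => //; apply/matrixP => i j; rewrite mxE.
    have [ik|/lE ->] := boolP (i < k)%N; first by rewrite redB // andbT.
    rewrite andbF; have [jk|/lE -> //] := boolP (j < k)%N.
    rewrite -symB mxE redB //; case: eqP => // jl.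
    by rewrite jl /= ltnn in jk.
  right; exists (B l l) => //; apply/matrixP => i j; rewrite !mxE.
  have [ik|/lE ->] := boolP (i < k)%N.
    by rewrite redB // ltn_eqF // (leq_ltn_trans ik kn).
  have kn1 : k.+1 = n by rewrite -(prednK n0) -km addn0.
  rewrite /= kn1 eqxx.
  have [jk|/lE ->] := boolP (j < k)%N; last by rewrite eqxx mulr1n.
  rewrite -symB mxE redB // eq_sym; case: eqP => // jl.
  by rewrite -jl ltnn in jk.
have [kn kn1] : (k < n)%N /\ (k.+1 < n)%N.
  by rewrite -(prednK n0) -km !ltnS leq_addr addnS ltnS leq_addr.
have [[i j] /= /and3P[ki kj Bij]|B0] :=
  pickP (fun ij : 'I_n * 'I_n => [&& (k <= ij.1)%N, (k <= ij.2)%N & B ij.1 ij.2 != 0]).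
  have [A elA redA] := reduced_step kn1 symB redB ki kj Bij.
  have [|A' elA' nfA'] := IHm k.+1 _ _ (congr_sym A symB) redA.
    by rewrite -km addSnnS.
  exists (A' *m A); first by constructor.
  by rewrite trmx_mul mulmxA -(mulmxA A') -(mulmxA A').
exists 1%:M; first by constructor.
rewrite mul1mx trmx1 mulmx1; left; exists k => //; apply/matrixP => i j; rewrite mxE.
have [ik|ki] := ltnP i k; first by rewrite redB // andbT.
rewrite andbF; have [jk|kj] := ltnP j k.
  rewrite -symB mxE redB // eq_sym; case: eqP => // eij.
  by rewrite eij leqNgt jk in ki.
by have := B0 (i, j); rewrite /= ki kj /= => /negbFE/eqP.
Qed.

Lemma det_last_diag b : (0 < n)%N -> \det (last_diag b) = b.
Proof.
move=> n0; have ln : (n.-1 < n)%N by rewrite prednK.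
rewrite det_diag (bigD1 (Ordinal ln)) //= mxE /= prednK // eqxx.
rewrite big1 ?mulr1 // => i il; rewrite mxE ifN //.
apply: contraNneq il => iE; apply/eqP/val_inj => /=.
exact: (congr1 predn iE).
Qed.

Lemma rank_last_diag b : (0 < n)%N -> b != 0 -> \rank (last_diag b) = n.
Proof. by move=> n0 b0; apply: mxrank_unit; rewrite unitmxE det_last_diag // unitfE. Qed.

Lemma rank_pid k : (k < n)%N -> \rank (pid_mx k : 'M[K]_n) = k.
Proof. by move=> kn; rewrite rank_pid_mx // ltnW. Qed.

Lemma normal_form_inj B B' : (0 < n)%N -> normal_form B -> normal_form B' ->
  \rank B = \rank B' -> \det B = \det B' -> B = B'.
Proof.
move=> n0 [[k kn ->]|[b b0 ->]] [[k' kn' ->]|[b' b0' ->]];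
  rewrite ?rank_pid ?rank_last_diag //.
- by move=> ->.
- by move=> kE; rewrite kE ltnn in kn.
- by move=> kE; rewrite -kE ltnn in kn'.
- by rewrite !det_last_diag // => _ ->.
Qed.

Lemma rank_congr P A B : elementary P A -> \rank (A *m B *m A^T) = \rank B.
Proof.
move=> /elementary_unit uA; rewrite mxrankMfree ?row_free_unit ?unitmx_tr //.
by rewrite -mxrank_tr trmx_mul mxrankMfree ?mxrank_tr // row_free_unit unitmx_tr.
Qed.

Lemma det_congr P A B : elementary P A -> \det (A *m B *m A^T) = \det B.
Proof. by move=> elA; rewrite !det_mulmx det_tr (det_elementary elA) mul1r mulr1. Qed.

(** Rank and determinant are invariant and determine the normal form. *)
Lemma elementary_orbit (x y : symmx K n) : (0 < n)%N ->
  \rank x = \rank y -> \det x = \det y ->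
  exists2 A, elementary predT A & y = congr_act A x.
Proof.
move=> n0 rk dt; have nf (z : symmx K n) :
    exists2 A, elementary predT A & normal_form (A *m z *m A^T).
  exact: (@reduced_normal_form n.-1 0 z n0 (add0n _) (eqP (valP z))).
have [[A elA nfA] [A' elA' nfA']] := (nf x, nf y).
have [uA uA'] := (elementary_unit elA, elementary_unit elA').
exists (invmx A' *m A).
  by constructor => //; apply: elementary_invmx.
rewrite -congr_actM -[LHS](congr_actK _ uA'); congr congr_act; apply: val_inj.
by apply: (normal_form_inj n0 nfA' nfA); rewrite ?(rank_congr _ elA) ?(rank_congr _ elA') ?(det_congr _ elA) ?(det_congr _ elA').
Qed.
End NormalForm.

(** * Collective transitivity *)

Section Main.
Variables (K : closedFieldType) (n : nat).
Hypothesis charK0 : [pchar K] =i pred0.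
Hypothesis n_ge2 : (2 <= n)%N.

Lemma sym_move_inj (phi : symmx K n -> symmx K n) : sym_move phi -> injective phi.
Proof. by case=> -[g _ gE] _ x y; rewrite -!gE; apply: can_inj (aut_funK g) x y. Qed.

(** One point at a time: once the first [m] points are in place, the next one
    is moved to its target by the stabilizer of the targets already reached. *)
Lemma collective_transitivity k (M M' : 'I_k -> symmx K n) :
  injective M -> injective M' ->
  (forall i, \rank (M i) = \rank (M' i)) -> (forall i, \det (M i) = \det (M' i)) ->
  exists2 phi, sym_move phi & forall i, phi (M i) = M' i.
Proof.
move=> M_inj M'_inj rk dt.
suff: forall m, exists2 phi, sym_move phi & forall i : 'I_k, (i < m)%N -> phi (M i) = M' i.
  by move=> /(_ k)[phi mphi phiE]; exists phi => // i; apply: phiE.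
elim=> [|m [phi mphi phiE]]; first by exists id => //; apply: sym_move_id.
have [mk|km] := ltnP m k; last first.
  by exists phi => // i _; apply: phiE; apply: leq_trans (ltn_ord i) km.
pose j := Ordinal mk; pose F := map M' [seq i : 'I_k <- enum 'I_k | (i < m)%N].
have inF (i : 'I_k) : (i < m)%N -> M' i \in F by move=> im; apply: map_f; rewrite mem_filter im mem_enum.
have phijNF : phi (M j) \notin F.
  apply/mapP => -[i]; rewrite mem_filter => /andP[im _]; rewrite -phiE // => /(sym_move_inj mphi).
  by move=> /M_inj ij; rewrite -ij ltnn in im.
have M'jNF : M' j \notin F.
  by apply/mapP => -[i]; rewrite mem_filter => /andP[im _] /M'_inj ij; rewrite -ij ltnn in im.
have [A elA AE] := mphi.2 (M j).
have [|||A' elA' A'E] := @elementary_orbit K n (char_two charK0) (phi (M j)) (M' j).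
- exact: ltnW.
- by rewrite AE (rank_congr _ elA).
- by rewrite AE (det_congr _ elA).
have [|psi [mpsi fixpsi psiE]] := linked_elementary charK0 n_ge2 elA' phijNF.
  by rewrite -A'E.
exists (psi \o phi); first exact: sym_move_comp.
move=> i; rewrite ltnS leq_eqVlt => /orP[/eqP im|im] /=.
  have -> : i = j by apply: val_inj.
  by rewrite psiE A'E.
by rewrite phiE // fixpsi // inF.
Qed.
End Main.

Theorem theorem3p5 (K : closedFieldType) (charK0 : [pchar K] =i pred0)
  (n : nat) (n_ge2 : (2 <= n)%N) (k : nat) (M M' : 'I_k -> symmx K n)
  (M_inj : injective M) (M'_inj : injective M')
  (rk_eq : forall i : 'I_k, \rank (M i) = \rank (M' i))
  (rk_ge2 : forall i : 'I_k, (2 <= \rank (M i))%N)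
  (det_eq : forall i : 'I_k, \det (M i) = \det (M' i)) :
  exists g : autX K n, Gsym g /\ forall i : 'I_k, g (M i) = M' i.
Proof.
have [phi [[g Gg gE] _] phiE] :=
  collective_transitivity charK0 n_ge2 M_inj M'_inj rk_eq det_eq.
by exists g; split=> // i; rewrite gE.
Qed.
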